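(* Let $l$ be a positive integer and let $H_1,\ldots,H_l$ be finite simple graphs. There are constants $C$ and $c$ that may depend only on $H_1,\ldots,H_l$ such that for all real numbers $\beta_1,\ldots,\beta_l$ and every positive integer $N$, with $B:=1+|\beta_1|+\cdots+|\beta_l|$, $$-cBN^{-1}\le\frac{\log Z_N}{N^2}-L_N\le CB^{8/5}N^{-1/5}(\log N)^{1/5}\biggl(1+\frac{\log B}{\log N}\biggr)+CB^2N^{-1/2},$$ where $$Z_N:=\sum_{G}\exp\bigl(N^2(\beta_1t(H_1,G)+\cdots+\beta_lt(H_l,G))\bigr),$$ the sum being over all simple graphs $G$ on the vertex set $\{1,\ldots,N\}$, and $$L_N:=\sup_{x\in\mathcal{P}_N}\biggl(\beta_1t(H_1,x)+\cdots+\beta_lt(H_l,x)-\frac{I(x)}{N^2}\biggr).$$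
   Context: For finite simple graphs $H,G$, $t(H,G):=\hom(H,G)/|V(G)|^{|V(H)|}$, where $\hom(H,G)$ is the number of homomorphisms (edge-preserving maps) from $V(H)$ to $V(G)$. $\mathcal{P}_N$ is the set of all $x=(x_{ij})_{1\le i<j\le N}$ with $x_{ij}\in[0,1]$ for all $i,j$, with the convention $x_{ii}=0$, $x_{ji}=x_{ij}$. For $H$ with vertex set $\{1,\ldots,k\}$ and edge set $E(H)$, and $x\in\mathcal{P}_N$, $$t(H,x):=\frac1{N^k}\sum_{q_1,\ldots,q_k=1}^N\ \prod_{\{l,l'\}\in E(H)}x_{q_lq_{l'}}.$$ For $u\in[0,1]$, $I(u):=u\log u+(1-u)\log(1-u)$ (with $0\log0=0$), and for $x\in\mathcal{P}_N$, $I(x):=\sum_{1\le i<j\le N}I(x_{ij})$. *)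

(* Defs.v *)
From HB Require Import structures.
From mathcomp Require Import all_boot all_order all_algebra.
From mathcomp Require Import all_classical all_reals all_analysis.

Set Implicit Arguments.
Unset Strict Implicit.
Unset Printing Implicit Defensive.

Import Order.TTheory GRing.Theory Num.Theory.

Local Open Scope ring_scope.

(* A simple graph on 'I_n is given by its adjacency relation, stored as a set
   of ordered pairs: each edge {i, j} appears as both (i, j) and (j, i). *)
Definition is_sgraph (n : nat) (E : {set 'I_n * 'I_n}) : bool :=
  [forall i, (i, i) \notin E] &&
  [forall i, forall j, ((i, j) \in E) == ((j, i) \in E)].

Record sgraph (n : nat) := SGraph {
  adj_set : {set 'I_n * 'I_n};
  adj_setP : is_sgraph adj_set }.

HB.instance Definition _ (n : nat) := [isSub for @adj_set n].
HB.instance Definition _ (n : nat) := [Countable of sgraph n by <:].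
HB.instance Definition _ (n : nat) := [Finite of sgraph n by <:].

Definition adj (n : nat) (G : sgraph n) : rel 'I_n :=
  fun i j => (i, j) \in adj_set G.

Definition is_hom (k n : nat) (H : sgraph k) (G : sgraph n)
    (f : {ffun 'I_k -> 'I_n}) : bool :=
  [forall a, forall b, adj H a b ==> adj G (f a) (f b)].

Definition hom (k n : nat) (H : sgraph k) (G : sgraph n) : nat :=
  #|[set f : {ffun 'I_k -> 'I_n} | is_hom H G f]|.

Definition hom_density (R : realType) (k n : nat) (H : sgraph k)
    (G : sgraph n) : R :=
  (hom H G)%:R / n%:R ^+ k.

(* A point (x_ij)_{i < j} of P_N is encoded as the full matrix obtained from
   the conventions x_ii = 0 and x_ji = x_ij. *)
Definition P_ (R : realType) (N : nat) : set 'M[R]_N :=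
  [set x | [/\ forall i j, 0 <= x i j <= 1,
               forall i, x i i = 0 &
               forall i j, x j i = x i j]]%classic.

(* The condition p.1 < p.2 makes each edge {p.1, p.2} count exactly once. *)
Definition hom_density_mx (R : realType) (k N : nat) (H : sgraph k)
    (x : 'M[R]_N) : R :=
  (N%:R ^+ k)^-1 *
  \sum_(q : {ffun 'I_k -> 'I_N})
    \prod_(p : 'I_k * 'I_k | (p.1 < p.2)%N && adj H p.1 p.2)
      x (q p.1) (q p.2).

(* 0 log 0 = 0 holds because ln is total. *)
Definition I_ent (R : realType) (u : R) : R :=
  u * ln u + (1 - u) * ln (1 - u).

Definition I_ent_mx (R : realType) (N : nat) (x : 'M[R]_N) : R :=
  \sum_(p : 'I_N * 'I_N | (p.1 < p.2)%N) I_ent (x p.1 p.2).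

Definition Z_ (R : realType) (l : nat) (k : 'I_l -> nat)
    (H : forall i, sgraph (k i)) (beta : 'I_l -> R) (N : nat) : R :=
  \sum_(G : sgraph N)
    expR (N%:R ^+ 2 * \sum_(i < l) beta i * hom_density R (H i) G).

(* The set below is nonempty and bounded above, so this real-valued sup is a
   genuine supremum and not the default value of sup. *)
Definition L_ (R : realType) (l : nat) (k : 'I_l -> nat)
    (H : forall i, sgraph (k i)) (beta : 'I_l -> R) (N : nat) : R :=
  sup [set \sum_(i < l) beta i * hom_density_mx (H i) x
           - I_ent_mx x / N%:R ^+ 2 | x in @P_ R N]%classic.

(* Main.v *)
Require Import Defs.
From mathcomp Require Import all_boot all_order all_algebra.
From mathcomp Require Import all_classical all_reals all_analysis.
From mathcomp Require Import ring lra.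

(* Lower bound: test the Gibbs variational principle against the product
   measure with edge probabilities [x].  Its expected homomorphism densities
   equal [t(H, x)] up to the contribution of non-injective maps, which is
   [O(1/N)].

   Upper bound: let [G] follow the Gibbs measure, and for a set [S] of vertices
   let [x_S(G)] be the matrix of conditional expectations of the edge indicators
   given the rows of [G] indexed by [S].  The average over [i, j] of
   [E (x_S)_ij ^ 2] lies in [0, 1] and can only increase with [S], so for some
   [S] of size [O(d^-2)] adding boundedly many vertices increases it by at most
   [d^2].  In a copy of [H] at vertices [q], all edges except [ab] lie in the
   rows of the [q_c] with [c] outside [{a, b}], so for this [S] the edge
   indicators can be replaced one at a time by the entries of [x_S]; hence
   [E t(H, G)] and [E t(H, x_S)] differ by [O(d)].  The rows in [S] take at most
   [2 ^ (|S| N)] values, so mixing product measures over them bounds the entropy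
   by [|S| N log 2 - E I(x_S)].  Taking [d = N ^ (-1/5)], the total error is
   [O(B N ^ (-1/5))], which is stronger than required. *)

Set Implicit Arguments.
Unset Strict Implicit.

Import Order.TTheory GRing.Theory Num.Theory.

Local Open Scope ring_scope.

(** * Finite probability spaces *)

(** Average [ln t <= t - 1] at [t = q / p]. Absolute continuity is assumed because [ln 0 = 0]: a
    point with [q = 0 < p] would count as 0 instead of minus infinity. *)
Lemma gibbs_inequality (R : realType) (O : finType) (p q : O -> R) :
  (forall o, 0 <= p o) -> (forall o, 0 <= q o) ->
  (forall o, 0 < p o -> 0 < q o) ->
  \sum_o p o = 1 -> \sum_o q o <= 1 ->
  \sum_o p o * ln (q o) <= \sum_o p o * ln (p o).
Proof.
move=> p0 q0 pq p1 q1; rewrite -subr_ge0 -sumrB.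
have: 0 <= \sum_o (p o - q o) by rewrite sumrB p1 subr_ge0.
move=> /le_trans; apply; apply: ler_sum => o _.
have [po|] := ltP 0 (p o); last first.
  move=> po; have -> : p o = 0 by apply/eqP; rewrite eq_le po p0.
  by rewrite !mul0r subr0 sub0r oppr_le0.
have qo := pq _ po.
have h : ln (q o / p o) <= q o / p o - 1.
  have := @le_ln1Dx R (q o / p o - 1); rewrite (addrC 1) subrK; apply.
  by rewrite ltrBDr addNr divr_gt0.
have := ler_wpM2l (p0 o) h.
rewrite ln_div ?posrE// !mulrBr mulr1 mulrCA divff ?gt_eqF// mulr1.
lra.
Qed.

(** * Conditional expectations as projections *)

Section ConditionalExpectation.
Variables (R : realType) (O : finType) (w : O -> R).
Hypothesis w_gt0 : forall o, 0 < w o.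

Definition expect (f : O -> R) : R := \sum_o w o * f o.

(** The information conditioned on is encoded by the fibres of an observation [s]; positive weights
    keep the denominator nonzero. *)
Definition cond_expect (T : eqType) (s : O -> T) (f : O -> R) (o : O) : R :=
  (\sum_(o' | s o' == s o) w o' * f o') / \sum_(o' | s o' == s o) w o'.

(** Measurability with respect to the partition into fibres of [s]. *)
Definition factors (T : eqType) (s : O -> T) (f : O -> R) : Prop :=
  forall o o', s o = s o' -> f o = f o'.

Lemma fiber_weight_gt0 (T : eqType) (s : O -> T) o :
  0 < \sum_(o' | s o' == s o) w o'.
Proof.
by rewrite (bigD1 o) //= ltr_pwDl // sumr_ge0 // => o' _; exact: ltW.
Qed.

Lemma factors_cond_expect (T : eqType) (s : O -> T) f :
  factors s (cond_expect s f).
Proof. by move=> o o' e; rewrite /cond_expect e. Qed.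

Lemma cond_expect_itv (T : eqType) (s : O -> T) f o :
  (forall o, 0 <= f o <= 1) -> 0 <= cond_expect s f o <= 1.
Proof.
move=> f01; have W0 := fiber_weight_gt0 s o.
have w0 o' := ltW (w_gt0 o').
rewrite /cond_expect ler_pdivrMr // mul1r divr_ge0 ?(ltW W0) //=.
  apply: ler_sum => o' _; rewrite ler_piMr //.
  by case/andP: (f01 o').
by apply: sumr_ge0 => o' _; rewrite mulr_ge0 //; case/andP: (f01 o').
Qed.

(** After exchanging the sums, [g] is constant on each fibre and the weight of the fibre cancels. *)
Lemma expect_cond_expect (T : eqType) (s : O -> T) f g : factors s g ->
  expect (fun o => cond_expect s f o * g o) = expect (fun o => f o * g o).
Proof.
move=> gs; rewrite /expect /cond_expect.
transitivity (\sum_o \sum_(o' | s o' == s o)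
    w o * g o * (w o' * f o') / \sum_(o'' | s o'' == s o) w o'').
  apply: eq_bigr => o _; rewrite mulr_suml mulr_suml mulr_sumr.
  by apply: eq_bigr => o' _; ring.
rewrite (exchange_big_dep xpredT) //=; apply: eq_bigr => o' _.
transitivity (w o' * f o' * g o' / (\sum_(o'' | s o'' == s o') w o'') *
   \sum_(o | s o == s o') w o); last first.
  by rewrite divfK ?gt_eqF ?fiber_weight_gt0 // mulrA.
rewrite mulr_sumr; apply: eq_big => [a|a /eqP e]; first by rewrite eq_sym.
by rewrite e (gs a o') //; ring.
Qed.

(** Pythagoras: [s'] refines [s], so the coarse conditional expectation is the orthogonal projection
    of the fine one. *)
Lemma expect_sqr_cond_expectB (T T' : eqType) (s : O -> T) (s' : O -> T') f :
  (forall o o', s' o = s' o' -> s o = s o') ->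
  expect (fun o => (cond_expect s' f o - cond_expect s f o) ^+ 2) =
  expect (fun o => cond_expect s' f o ^+ 2) -
  expect (fun o => cond_expect s f o ^+ 2).
Proof.
move=> ref.
have h1 : expect (fun o => cond_expect s' f o * cond_expect s f o) =
          expect (fun o => f o * cond_expect s f o).
  by apply: expect_cond_expect => o o' /ref; exact: factors_cond_expect.
have h2 : expect (fun o => cond_expect s f o * cond_expect s f o) =
          expect (fun o => f o * cond_expect s f o).
  by apply: expect_cond_expect; exact: factors_cond_expect.
rewrite [X in _ - X](_ : _ = 2 * expect (fun o => f o * cond_expect s f o) -
   expect (fun o => cond_expect s f o * cond_expect s f o)); last first.
  rewrite -h2 mulr_natl mulr2n addrK; apply: eq_bigr => o _; ring.
rewrite -[in 2 * _]h1 /expect mulr_sumr -!sumrB.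
by apply: eq_bigr => o _; ring.
Qed.

Hypothesis w_sum1 : \sum_o w o = 1.
Variable d : R.
Hypothesis d_gt0 : 0 < d.

(** With [t] the difference of the two conditional expectations, this is the mean of
    [(d + t ^ 2 / d) / 2], an upper bound for [|t|]. It is linear in the energy gain, so it can be
    averaged over copies of a graph. *)
Definition replacement_cost (T T' : eqType) (s : O -> T) (s' : O -> T') f : R :=
  (d + (expect (fun o => cond_expect s' f o ^+ 2) -
        expect (fun o => cond_expect s f o ^+ 2)) / d) / 2.

(* Since [g] factors through [s'], [f] may first be replaced by its conditional
   expectation given [s']; AM-GM then bounds the L1 norm of the difference. *)
Lemma expect_replace (T T' : eqType) (s : O -> T) (s' : O -> T') f g :
  (forall o o', s' o = s' o' -> s o = s o') ->
  factors s' g -> (forall o, `|g o| <= 1) ->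
  `|expect (fun o => (f o - cond_expect s f o) * g o)| <=
   replacement_cost s s' f.
Proof.
move=> ref gs g1.
rewrite /replacement_cost -expect_sqr_cond_expectB //.
have -> : expect (fun o => (f o - cond_expect s f o) * g o) =
          expect (fun o => (cond_expect s' f o - cond_expect s f o) * g o).
  have e h : expect (fun o => (h o - cond_expect s f o) * g o) =
     expect (fun o => h o * g o) - expect (fun o => cond_expect s f o * g o).
    by rewrite /expect -sumrB; apply: eq_bigr => o _; ring.
  by rewrite !e (expect_cond_expect f gs).
set t := fun o => cond_expect s' f o - cond_expect s f o.
have -> : (d + expect (fun o => t o ^+ 2) / d) / 2 =
          \sum_o w o * ((d + t o ^+ 2 / d) / 2).
  have {1}-> : d = \sum_o w o * d by rewrite -mulr_suml w_sum1 mul1r.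
  rewrite /expect !mulr_suml -big_split mulr_suml; apply: eq_bigr => o _ /=.
  by ring.
apply: le_trans (ler_norm_sum _ _ _) _; apply: ler_sum => o _ /=.
rewrite normrM (gtr0_norm (w_gt0 o)) -/(t o).
apply: ler_wpM2l; first exact: ltW.
apply: (@le_trans _ _ `|t o|); first by rewrite normrM ler_piMr.
rewrite ler_pdivlMr // -(ler_pM2r d_gt0) mulrDl divfK ?gt_eqF //.
rewrite -(real_normK (num_real (t o))).
have := sqr_ge0 (d - `|t o|); rewrite sqrrB; lra.
Qed.

(** Telescoping over [es]: while [X e] is replaced, the factors still to come are determined by
    [s' e]; those already replaced are determined by [s] and absorbed into [g], which is why the
    induction varies [g]. *)
Lemma expect_prod_replace (I T T' : eqType) (s : O -> T) (s' : I -> O -> T')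
    (X : I -> O -> R) (es : seq I) (g : O -> R) :
  uniq es ->
  (forall e o, 0 <= X e o <= 1) ->
  (forall e o o', s' e o = s' e o' -> s o = s o') ->
  {in es &, forall e e', e != e' -> factors (s' e) (X e')} ->
  factors s g -> (forall o, `|g o| <= 1) ->
  `|expect (fun o => g o * (\prod_(e <- es) X e o -
                            \prod_(e <- es) cond_expect s (X e) o))| <=
  \sum_(e <- es) replacement_cost s (s' e) (X e).
Proof.
move=> + X01 ref; elim: es g => [|e es IH] g /=.
  move=> _ _ _ _; rewrite big_nil /expect big1 ?normr0 // => o _.
  by rewrite !big_nil subrr !mulr0.
move=> /andP[ees ues] Xs gs g1.
have n1 (h : I -> O -> R) o r : (forall e o, 0 <= h e o <= 1) ->
    `|\prod_(e <- r) h e o| <= 1.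
  move=> h01; rewrite normr_prod prodr_ile1 // => i _; rewrite normr_ge0 /=.
  by rewrite ger0_norm; case/andP: (h01 i o).
have c01 f : (forall o, 0 <= f o <= 1) -> forall o, 0 <= cond_expect s f o <= 1.
  by move=> f01 o; apply: cond_expect_itv.
have -> : expect (fun o => g o * (\prod_(e <- e :: es) X e o -
                            \prod_(e <- e :: es) cond_expect s (X e) o)) =
  expect (fun o => (X e o - cond_expect s (X e) o) *
                   (g o * \prod_(e <- es) X e o)) +
  expect (fun o => g o * cond_expect s (X e) o * (\prod_(e <- es) X e o -
                            \prod_(e <- es) cond_expect s (X e) o)).
  rewrite /expect -big_split; apply: eq_bigr => o _ /=; rewrite !big_cons; ring.
rewrite big_cons; apply: le_trans (ler_normD _ _) _; apply: lerD.
  apply: expect_replace; first exact: ref.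
    move=> o o' oo'; congr (_ * _); first exact/gs/(ref _ _ _ oo').
    apply: eq_big_seq => e' e'es; apply: (Xs e e') oo' => //.
    - exact: mem_head.
    - by rewrite inE e'es orbT.
    - by apply: contraNneq ees => ->.
  by move=> o; rewrite normrM mulr_ile1 // n1.
apply: IH => //.
- by move=> a b aes bes; apply: Xs; rewrite inE ?aes ?bes orbT.
- move=> o o' oo'; congr (_ * _); first exact: gs.
  exact: factors_cond_expect.
- move=> o; rewrite normrM mulr_ile1 //.
  by rewrite ger0_norm; case/andP: (c01 _ (X01 e) o).
Qed.

End ConditionalExpectation.

(** * Product measures on graphs *)

Lemma adj_sym N (G : sgraph N) i j : adj G i j = adj G j i.
Proof. by have /andP[_ /forallP/(_ i)/forallP/(_ j)/eqP] := adj_setP G. Qed.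

Lemma adj_irr N (G : sgraph N) i : adj G i i = false.
Proof. by have /andP[/forallP/(_ i)/negbTE] := adj_setP G. Qed.

Definition upper_sym N (f : {ffun 'I_N * 'I_N -> bool}) : {set 'I_N * 'I_N} :=
  [set p : 'I_N * 'I_N | (p.1 < p.2)%N && f p || (p.2 < p.1)%N && f (p.2, p.1)]%SET.

Lemma upper_sym_sgraph N (f : {ffun 'I_N * 'I_N -> bool}) :
  is_sgraph (upper_sym f).
Proof.
apply/andP; split; apply/forallP => i; first by rewrite inE /= ltnn.
by apply/forallP => j; rewrite !inE /= orbC.
Qed.

(** Graphs correspond to Boolean functions supported on increasing pairs, so the left side is the
    expanded product of two-term sums. *)
Lemma sum_sgraph_prod (R : realType) N (F : 'I_N * 'I_N -> bool -> R) :
  \sum_(G : sgraph N) \prod_(p : 'I_N * 'I_N | (p.1 < p.2)%N)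
    F p (adj G p.1 p.2) =
  \prod_(p : 'I_N * 'I_N | (p.1 < p.2)%N) (F p true + F p false).
Proof.
under [RHS]eq_bigr => p _ do rewrite -(big_bool _ (F p)).
(* The default [false] restricts the expansion to functions vanishing off increasing pairs; on these
   [h] and [h'] are mutually inverse. *)
rewrite (big_distr_big false).
pose h f := SGraph (upper_sym_sgraph f) : sgraph N.
pose h' (G : sgraph N) : {ffun 'I_N * 'I_N -> bool} :=
  [ffun p : 'I_N * 'I_N => (p.1 < p.2)%N && adj G p.1 p.2].
have hE f (p : 'I_N * 'I_N) : (p.1 < p.2)%N -> adj (h f) p.1 p.2 = f p.
  by move=> lt; rewrite /adj inE /= lt ltnNge (ltnW lt) /= orbF -surjective_pairing.
rewrite (reindex_onto h h') /=; last first.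
  move=> G _; apply/val_inj/setP => -[i j]; rewrite !inE !ffunE /=.
  rewrite -/(adj G i j) (adj_sym G j i).
  by have [//|//|/val_inj ->] := ltngtP i j; rewrite ?orbF ?adj_irr.
apply: eq_big => [f|f _]; last by apply: eq_bigr => p lt; rewrite hE.
apply/eqP/pffun_onP => [<-|[/fintype.subsetP sub _]].
  split; last by move=> b _.
  by apply/fintype.subsetP => p; rewrite !inE ffunE eqbF_neg negbK; case/andP.
apply/ffunP => p; rewrite ffunE.
have [lt|nlt] := boolP (p.1 < p.2)%N; first by rewrite hE.
apply/esym/negbTE; apply: contra nlt => fp; apply: (sub p).
by rewrite inE fp.
Qed.

Definition bernoulli_graph (R : realType) N (x : 'M[R]_N) (G : sgraph N) : R :=
  \prod_(p : 'I_N * 'I_N | (p.1 < p.2)%N)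
    if adj G p.1 p.2 then x p.1 p.2 else 1 - x p.1 p.2.

(** Independence of distinct edges. Taking [D] empty or a singleton gives the total mass and the
    marginals. *)
Lemma bernoulli_graph_edges (R : realType) N (x : 'M[R]_N)
    (D : pred ('I_N * 'I_N)) : (forall p, D p -> (p.1 < p.2)%N) ->
  \sum_(G : sgraph N) bernoulli_graph x G *
     \prod_(p | D p) (adj G p.1 p.2)%:R = \prod_(p | D p) x p.1 p.2.
Proof.
move=> Dlt.
have DE (F : 'I_N * 'I_N -> R) : \prod_(p | D p) F p =
    \prod_(p : 'I_N * 'I_N | (p.1 < p.2)%N) if D p then F p else 1.
  rewrite big_mkcond [RHS]big_mkcond; apply: eq_bigr => p _.
  by have := Dlt p; case: (D p) => [->|] //; rewrite if_same.
pose F (p : 'I_N * 'I_N) (b : bool) : R :=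
  (if b then x p.1 p.2 else 1 - x p.1 p.2) * (if D p then b%:R else 1).
transitivity (\prod_(p : 'I_N * 'I_N | (p.1 < p.2)%N) (F p true + F p false)).
  rewrite -sum_sgraph_prod; apply: eq_bigr => G _.
  by rewrite DE -big_split.
rewrite DE; apply: eq_bigr => p _; rewrite /F.
by case: (D p); rewrite /= ?mulr1 ?mulr0 ?addr0 // addrC subrK.
Qed.

Lemma sum_bernoulli_graph (R : realType) N (x : 'M[R]_N) :
  \sum_(G : sgraph N) bernoulli_graph x G = 1.
Proof.
have := @bernoulli_graph_edges R N x pred0.
rewrite big_pred0_eq => <- //; apply: eq_bigr => G _.
by rewrite big_pred0_eq mulr1.
Qed.

Lemma bernoulli_graph_ge0 (R : realType) N (x : 'M[R]_N) G :
  (forall i j, 0 <= x i j <= 1) -> 0 <= bernoulli_graph x G.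
Proof.
move=> x01; apply: prodr_ge0 => p _; case: ifP => _;
by case/andP: (x01 p.1 p.2) => // *; rewrite subr_ge0.
Qed.

Lemma ln_prod (R : realType) (I : finType) (P : pred I) (F : I -> R) :
  (forall i, P i -> 0 < F i) ->
  ln (\prod_(i | P i) F i) = \sum_(i | P i) ln (F i).
Proof.
move=> F0.
have [] : 0 < \prod_(i | P i) F i /\
  ln (\prod_(i | P i) F i) = \sum_(i | P i) ln (F i) => //.
elim/big_rec2 : _ => [|i s t Pi [t0 <-]]; first by rewrite ln1 ltr01.
by rewrite lnM ?posrE ?F0 // mulr_gt0 ?F0.
Qed.

Lemma ln_bernoulli_graph (R : realType) N (x : 'M[R]_N) G :
  (forall i j, 0 <= x i j <= 1) -> 0 < bernoulli_graph x G ->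
  ln (bernoulli_graph x G) = \sum_(p : 'I_N * 'I_N | (p.1 < p.2)%N)
    ((adj G p.1 p.2)%:R * ln (x p.1 p.2) +
     (1 - (adj G p.1 p.2)%:R) * ln (1 - x p.1 p.2)).
Proof.
move=> x01 /lt0r_neq0/prodf_neq0 n0.
rewrite /bernoulli_graph ln_prod => [|p pU].
  apply: eq_bigr => p _; case: ifP => _ /=.
    by rewrite subrr mul1r mul0r addr0.
  by rewrite mul0r subr0 mul1r add0r.
rewrite lt0r n0 //=; case: ifP => _; case/andP: (x01 p.1 p.2) => // *.
by rewrite subr_ge0.
Qed.

(** Entropy is additive over independent edges; graphs of weight 0 contribute nothing, and the
    logarithm is expanded on the others. *)
Lemma bernoulli_graph_entropy (R : realType) N (x : 'M[R]_N) :
  (forall i j, 0 <= x i j <= 1) ->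
  \sum_(G : sgraph N) bernoulli_graph x G * ln (bernoulli_graph x G) =
  I_ent_mx x.
Proof.
move=> x01.
transitivity (\sum_(G : sgraph N) \sum_(p : 'I_N * 'I_N | (p.1 < p.2)%N)
    (bernoulli_graph x G * (adj G p.1 p.2)%:R * ln (x p.1 p.2) +
     (bernoulli_graph x G - bernoulli_graph x G * (adj G p.1 p.2)%:R) *
     ln (1 - x p.1 p.2))).
  apply: eq_bigr => G _; have := bernoulli_graph_ge0 G x01.
  rewrite le_eqVlt => /predU1P[<-|b0].
    by rewrite mul0r big1 // => p _; rewrite !(mul0r, subrr, addr0).
  rewrite ln_bernoulli_graph // mulr_sumr; apply: eq_bigr => p _; ring.
rewrite exchange_big; apply: eq_bigr => p pU; rewrite big_split -!mulr_suml.
rewrite sumrB sum_bernoulli_graph.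
have := @bernoulli_graph_edges R N x (pred1 p).
rewrite big_pred1_eq => E.
rewrite (_ : \sum_G bernoulli_graph x G * _ = x p.1 p.2) // -[RHS]E.
  by apply: eq_bigr => G _; rewrite big_pred1_eq.
by move=> p' /eqP ->.
Qed.

(** * Energy increment and resampling *)

(** Greedy enlargement: as long as [S] fails, some [T] of at most [K] elements raises [Phi] by more
    than [e], which [Phi <= 1] allows at most [1 / e] times. *)
Lemma energy_increment (R : realType) (V : finType) (Phi : {set V} -> R)
    (K : nat) (e : R) :
  (forall S, 0 <= Phi S <= 1) -> 0 < e ->
  exists S : {set V}, #|S|%:R <= K%:R * (e^-1 + 1) /\
    forall T : {set V}, (#|T| <= K)%N -> Phi (S :|: T) <= Phi S + e.
Proof.
move=> Phi01 e0.
pose good S := forall T : {set V}, (#|T| <= K)%N -> Phi (S :|: T) <= Phi S + e.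
have step n : (exists S : {set V}, (#|S| <= K * n)%N /\ good S) \/
              (exists S : {set V}, (#|S| <= K * n)%N /\ n%:R * e <= Phi S).
  elim: n => [|n [[S [cS gS]]|[S [cS gS]]]].
  - right; exists finset.set0; rewrite cards0 mul0r; split=> //.
    by case/andP: (Phi01 finset.set0).
  - left; exists S; split=> //; apply: (leq_trans cS); rewrite leq_mul2l leqnSn.
    by rewrite orbT.
  have [gS'|] := pselect (good S).
    left; exists S; split=> //; apply: (leq_trans cS); rewrite leq_mul2l leqnSn.
    by rewrite orbT.
  move=> /existsNP[T /not_implyP[cT /negP]]; rewrite -ltNge => incr.
  right; exists (S :|: T)%SET; split.
    by rewrite (leq_trans (leq_card_setU _ _).1) // mulnS addnC leq_add.
  rewrite -natr1 mulrDl mul1r (le_trans _ (ltW incr)) //; exact: lerD.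
have ei0 : 0 < e^-1 by rewrite invr_gt0.
have /andP[le lt] := truncn_itv (ltW ei0).
have [[S [cS gS]]|[S [cS gS]]] := step (Num.truncn e^-1).+1; exists S.
  split=> //; apply: (@le_trans _ _ (K * (Num.truncn e^-1).+1)%:R).
    by rewrite ler_nat.
  by rewrite natrM ler_wpM2l // -natr1 lerD2r.
(* The second alternative is absurd: this many increments push [Phi] above 1. *)
move: lt; rewrite -(ltr_pM2r e0) mulVf ?gt_eqF // => lt.
by have := le_lt_trans (le_trans gS (proj2 (andP (Phi01 S)))) lt; rewrite ltxx.
Qed.

Definition resample (K V : finType) (q : {ffun K -> V}) (a : K) (x : V) :
  {ffun K -> V} := [ffun c => if c == a then x else q c].

(* Resampling one coordinate preserves the uniform measure: the map
   [(q, x) |-> (resample q a x, q a)] is an involution. *)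
Lemma sum_resample (R : realType) (K V : finType) (g : {ffun K -> V} -> R) a :
  \sum_q \sum_x g (resample q a x) = #|V|%:R * \sum_q g q.
Proof.
pose h (z : {ffun K -> V} * V) := (resample z.1 a z.2, z.1 a).
have hK : involutive h.
  move=> [q x]; rewrite /h /= ffunE eqxx; congr pair.
  by apply/ffunP => c; rewrite !ffunE; case: eqP => [->|].
rewrite pair_big (reindex_inj (inv_inj hK)) /=.
transitivity (\sum_(z : {ffun K -> V} * V) g z.1).
  by apply: eq_bigr => z _; rewrite -[in RHS](hK z).
rewrite -(pair_big xpredT xpredT (fun q _ => g q)) /= mulr_sumr.
by apply: eq_bigr => q _; rewrite sumr_const mulr_natl.
Qed.

(** Makes the images of two vertices of [H] run over all vertex pairs while the images of the others
    stay fixed. *)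
Lemma sum_resample2 (R : realType) (K V : finType) (g : {ffun K -> V} -> R)
    a b :
  \sum_q \sum_x \sum_y g (resample (resample q a x) b y) =
  #|V|%:R ^+ 2 * \sum_q g q.
Proof.
rewrite (sum_resample (fun q => \sum_y g (resample q b y))) sum_resample.
by rewrite mulrA.
Qed.

(** * Conditioning on the rows of a vertex set *)

Definition sorted_edge k (H : sgraph k) : pred ('I_k * 'I_k) :=
  fun p => (p.1 < p.2)%N && adj H p.1 p.2.

Definition adj_mx (R : realType) N (G : sgraph N) : 'M[R]_N :=
  \matrix_(i, j) (adj G i j)%:R.

(** A product of adjacency indicators is the indicator of a homomorphism; a violated edge found in
    decreasing order is flipped by symmetry. *)
Lemma hom_density_adj_mx (R : realType) k N (H : sgraph k) (G : sgraph N) :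
  hom_density R H G = hom_density_mx H (adj_mx R G).
Proof.
rewrite /hom_density /hom_density_mx mulrC; congr (_ * _).
rewrite /Defs.hom -sum1_card natr_sum big_mkcond; apply: eq_bigr => q _.
rewrite inE.
case: ifPn => [/forallP hq|].
  rewrite big1 // => p /andP[_ pH]; rewrite mxE.
  by have /forallP/(_ p.2)/implyP -> := hq p.1.
rewrite negb_forall => /existsP[a]; rewrite negb_forall => /existsP[b].
rewrite negb_imply => /andP[ab nab]; apply/esym/eqP/prodf_eq0.
have [lt|lt|/val_inj e] := ltngtP a b.
- exists (a, b); rewrite /sorted_edge /= ?lt // mxE.
  by rewrite (negbTE nab).
- exists (b, a); rewrite /sorted_edge /= ?lt ?(adj_sym H b) // mxE.
  by rewrite adj_sym (negbTE nab).
- by move: ab; rewrite e adj_irr.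
Qed.

Lemma prod_sorted_edge_itv (R : realType) k N (H : sgraph k) (x : 'M[R]_N)
    (q : 'I_k -> 'I_N) :
  (forall i j, 0 <= x i j <= 1) ->
  0 <= \prod_(p | sorted_edge H p) x (q p.1) (q p.2) <= 1.
Proof.
move=> x01; rewrite prodr_ile1 // andbT.
by apply: prodr_ge0 => p _; case/andP: (x01 (q p.1) (q p.2)).
Qed.

Lemma adj_mx_itv (R : realType) N (G : sgraph N) i j :
  0 <= adj_mx R G i j <= 1.
Proof. by rewrite mxE ler0n lern1 leq_b1. Qed.

(** The information revealed by [S]: since edges are stored in both orders, it determines every
    adjacency with at least one end in [S]. *)
Definition rows N (S : {set 'I_N}) (G : sgraph N) : {set 'I_N * 'I_N} :=
  [set p in adj_set G | p.1 \in S]%SET.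

Lemma rowsU N (S T : {set 'I_N}) (G G' : sgraph N) :
  rows (S :|: T) G = rows (S :|: T) G' -> rows S G = rows S G'.
Proof.
move=> /setP e; apply/setP => p; have := e p; rewrite !inE.
by case: (p.1 \in S); rewrite ?andbT ?andbF.
Qed.

Lemma rows_adj N (S : {set 'I_N}) (G G' : sgraph N) i j :
  rows S G = rows S G' -> (i \in S) || (j \in S) -> adj G i j = adj G' i j.
Proof.
move=> /setP e; wlog iS : i j / i \in S => [h|_].
  by case/orP => ?; [|rewrite adj_sym (adj_sym G')]; apply: h => //; apply/orP; left.
by have := e (i, j); rewrite !inE iS !andbT.
Qed.

Section RowMean.
Variables (R : realType) (N : nat) (w : sgraph N -> R).
Hypothesis w_gt0 : forall G, 0 < w G.
Hypothesis w_sum1 : \sum_G w G = 1.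
Hypothesis N_gt0 : (0 < N)%N.

Definition row_mean (S : {set 'I_N}) (G : sgraph N) : 'M[R]_N :=
  \matrix_(i, j) cond_expect w (rows S) (fun G => adj_mx R G i j) G.

Lemma row_mean_itv S G i j : 0 <= row_mean S G i j <= 1.
Proof. by rewrite mxE cond_expect_itv // => G'; exact: adj_mx_itv. Qed.

Lemma row_mean_P S G : P_ (row_mean S G).
Proof.
split=> [i j|i|i j]; first exact: row_mean_itv.
  by rewrite mxE /cond_expect big1 ?mul0r // => G' _; rewrite mxE adj_irr mulr0.
rewrite !mxE /cond_expect; congr (_ / _); apply: eq_bigr => G' _.
by rewrite !mxE adj_sym.
Qed.

Definition energy (S : {set 'I_N}) i j : R :=
  expect w (fun G => row_mean S G i j ^+ 2).

(** The energy of regularity-lemma arguments; by Pythagoras it can only grow with [S]. *)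
Definition mean_energy (S : {set 'I_N}) : R :=
  (N%:R ^+ 2)^-1 * \sum_i \sum_j energy S i j.

Lemma energy_itv S i j : 0 <= energy S i j <= 1.
Proof.
rewrite /energy /expect; apply/andP; split.
  by apply: sumr_ge0 => G _; rewrite mulr_ge0 ?sqr_ge0 // ltW.
rewrite -w_sum1; apply: ler_sum => G _; rewrite ler_piMr ?(ltW (w_gt0 G)) //.
by case/andP: (row_mean_itv S G i j) => *; rewrite exprn_ile1.
Qed.

Lemma mean_energy_itv S : 0 <= mean_energy S <= 1.
Proof.
rewrite /mean_energy; apply/andP; split.
  rewrite mulr_ge0 ?invr_ge0 ?exprn_ge0 //.
  by apply: sumr_ge0 => i _; apply: sumr_ge0 => j _; case/andP: (energy_itv S i j).
rewrite ler_pdivrMl ?exprn_gt0 ?ltr0n // mulr1.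
apply: (@le_trans _ _ (\sum_(i < N) \sum_(j < N) 1)).
  by apply: ler_sum => i _; apply: ler_sum => j _; case/andP: (energy_itv S i j).
by rewrite !sumr_const card_ord -mulr_natl mulr1 -natrX -mulnn -mulrnA.
Qed.

(** In a copy [q], replacing the indicator of [e] costs [(d + D e q / d) / 2]. Averaged over the
    images of the ends of [e], [D e q] is an increment of [mean_energy], hence at most [d ^ 2], so
    each edge costs at most [d]. *)
Lemma hom_density_row_mean k (H : sgraph k) (K : nat) (S : {set 'I_N}) (d : R) :
  0 < d -> (k <= K)%N ->
  (forall T : {set 'I_N}, (#|T| <= K)%N ->
     mean_energy (S :|: T) <= mean_energy S + d ^+ 2) ->
  `|expect w (fun G => hom_density_mx H (adj_mx R G) -
                       hom_density_mx H (row_mean S G))| <= (k ^ 2)%:R * d.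
Proof.
move=> d0 kK goodS.
have n0 : 0 < N%:R :> R by rewrite ltr0n.
pose es := [seq p <- index_enum ('I_k * 'I_k)%type | sorted_edge H p].
(* The images of the vertices off [e]: this set ignores where the ends of [e] go, and its rows
   reveal all other edges of the copy. *)
pose T (e : 'I_k * 'I_k) (q : {ffun 'I_k -> 'I_N}) : {set 'I_N} :=
  [set q c | c in [set c | (c != e.1) && (c != e.2)]]%SET.
have cT e q : (#|T e q| <= K)%N.
  apply: leq_trans (leq_imset_card _ _) (leq_trans (max_card _) _).
  by rewrite card_ord.
pose D e q : R := energy (S :|: T e q) (q e.1) (q e.2) - energy S (q e.1) (q e.2).
have step (q : {ffun 'I_k -> 'I_N}) : `|expect w (fun G => \prod_(e <- es) adj_mx R G (q e.1) (q e.2) -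
      \prod_(e <- es) row_mean S G (q e.1) (q e.2))| <=
    \sum_(e <- es) (d + D e q / d) / 2.
  have := @expect_prod_replace R _ w w_gt0 w_sum1 d d0 _ _ _ (rows S)
    (fun e => rows (S :|: T e q)) (fun e G => adj_mx R G (q e.1) (q e.2))
    es (fun=> 1).
  rewrite (_ : expect w _ = expect w (fun G =>
      \prod_(e <- es) adj_mx R G (q e.1) (q e.2) -
      \prod_(e <- es) row_mean S G (q e.1) (q e.2))); last first.
    apply: eq_bigr => G _; rewrite mul1r; congr (_ * (_ - _)).
    by apply: eq_bigr => e _; rewrite mxE.
  rewrite (_ : \sum_(e <- es) replacement_cost _ _ _ _ _ =
      \sum_(e <- es) (d + D e q / d) / 2); last first.
    apply: eq_bigr => e _; rewrite /replacement_cost /D /energy.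
    by congr ((_ + (_ - _) / _) / _); apply: eq_bigr => G _; rewrite mxE.
  apply.
  - by rewrite filter_uniq ?index_enum_uniq.
  - by move=> *; exact: adj_mx_itv.
  - by move=> e G G'; exact: rowsU.
  - move=> e e'; rewrite !mem_filter => /andP[/andP[e12 _] _].
    case/andP=> /andP[e12' _] _ ne G G' eG; rewrite !mxE.
    congr (_ %:R); congr nat_of_bool; apply: rows_adj eG _; rewrite !inE.
    have inT c : c != e.1 -> c != e.2 -> q c \in T e q.
      by move=> c1 c2; apply: imset_f; rewrite inE c1 c2.
    (* Some end of [e'] lies off [e]: otherwise [e' = e], as both pairs are increasing. *)
    have [|n1] := boolP (e'.1 \in [:: e.1; e.2]); last first.
      move: n1; rewrite !inE negb_or => /andP[? ?].
      by rewrite (inT e'.1) ?orbT.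
    have [|n2] := boolP (e'.2 \in [:: e.1; e.2]); last first.
      move: n2; rewrite !inE negb_or => /andP[? ?].
      by rewrite (inT e'.2) ?orbT.
    rewrite !inE; case: e e' ne e12 e12' {inT} => [a b] [a' b'] /= ne ab ab'.
    move=> /orP[]/eqP ea /orP[]/eqP eb; move: ne ab'; rewrite ea eb ?eqxx ?ltnn //.
    by rewrite ltnNge (ltnW ab).
  - by [].
  - by move=> G; rewrite normr1.
have sumD e : e \in es -> \sum_q D e q <= N%:R ^+ k * d ^+ 2.
  rewrite mem_filter => /andP[/andP[e12 _] _].
  have ne : (e.1 == e.2) = false by apply/negbTE; rewrite neq_ltn e12.
  have TE q x y : T e (resample (resample q e.1 x) e.2 y) = T e q.
    apply: eq_in_imset => c; rewrite inE !ffunE => /andP[/negbTE -> /negbTE ->] //.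
  rewrite -(ler_pM2l (exprn_gt0 2 n0)).
  have := sum_resample2 (D e) e.1 e.2; rewrite card_ord => <-.
  apply: (@le_trans _ _ (\sum_(q : {ffun 'I_k -> 'I_N}) N%:R ^+ 2 * d ^+ 2)).
    apply: ler_sum => q _.
    have -> : \sum_x \sum_y D e (resample (resample q e.1 x) e.2 y) =
       N%:R ^+ 2 * (mean_energy (S :|: T e q) - mean_energy S).
      rewrite mulrBr /mean_energy !mulrA divff ?expf_neq0 ?gt_eqF // !mul1r.
      rewrite -sumrB; apply: eq_bigr => x _; rewrite -sumrB.
      apply: eq_bigr => y _; rewrite /D TE.
      by rewrite !ffunE !eqxx ne.
    rewrite ler_pM2l ?exprn_gt0 // lerBlDl; exact: goodS.
  by rewrite sumr_const card_ffun !card_ord -[leLHS]mulr_natl natrX mulrCA.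
rewrite (_ : expect w _ = (N%:R ^+ k)^-1 * \sum_(q : {ffun 'I_k -> 'I_N})
    expect w (fun G => \prod_(e <- es) adj_mx R G (q e.1) (q e.2) -
      \prod_(e <- es) row_mean S G (q e.1) (q e.2))); last first.
  rewrite /expect exchange_big mulr_sumr; apply: eq_bigr => G _.
  rewrite /hom_density_mx -mulrBr -sumrB -mulr_sumr mulrCA; congr (_ * (_ * _)).
  by apply: eq_bigr => q _; rewrite !big_filter.
rewrite normrM gtr0_norm ?invr_gt0 ?exprn_gt0 // ler_pdivrMl ?exprn_gt0 //.
apply: (le_trans (ler_norm_sum _ _ _)).
apply: (le_trans (ler_sum _ (fun q _ => step q))).
rewrite exchange_big /=.
apply: (@le_trans _ _ (\sum_(e <- es) N%:R ^+ k * d)).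
  rewrite big_seq [leRHS]big_seq; apply: ler_sum => e /sumD sDe.
  rewrite -mulr_suml [X in X / 2]big_split /= sumr_const card_ffun !card_ord.
  rewrite -mulr_suml -[d *+ _]mulr_natl natrX.
  have : (\sum_q D e q) / d <= N%:R ^+ k * d.
    by rewrite ler_pdivrMr // -mulrA -expr2.
  by lra.
rewrite big_const_seq count_predT iter_addr_0 -[leLHS]mulr_natl mulrCA.
rewrite ler_pM2l ?exprn_gt0 // ler_pM2r // ler_nat.
apply: (@leq_trans #|{: 'I_k * 'I_k}|); last by rewrite card_prod card_ord.
rewrite -(card_uniqP _) ?filter_uniq ?index_enum_uniq //; exact: max_card.
Qed.

(** Gibbs' inequality against [c * bernoulli_graph (row_mean S G) G]: [ln c] pays for the rows, and
    the rest is the entropy of edges made independent given the rows. *)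
Lemma entropy_rows (S : {set 'I_N}) :
  - expect w (fun G => ln (w G)) <=
  (#|S| * N)%:R * ln 2 - expect w (fun G => I_ent_mx (row_mean S G)).
Proof.
(* The rows of [S] have [#|S| * N] entries, hence at most [2 ^ (#|S| * N)] patterns. *)
pose c : R := (2 ^+ (#|S| * N))^-1.
have c0 : 0 < c by rewrite invr_gt0 exprn_gt0.
have adj01 (i j : 'I_N) (G : sgraph N) : 0 <= adj_mx R G i j <= 1 by exact: adj_mx_itv.
(* [G] lies in its own fibre with positive weight, so [row_mean] is above 0 at its edges and below 1
   at its non-edges. *)
have b0 G : 0 < bernoulli_graph (row_mean S G) G.
  apply: prodr_gt0 => p _; rewrite mxE; have W0 := fiber_weight_gt0 w_gt0 (rows S) G.
  rewrite /cond_expect; case: ifPn => pG.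
    rewrite divr_gt0 // (bigD1 G) //= ltr_pwDl ?mxE ?pG ?mulr1 //.
    by apply: sumr_ge0 => G' _; rewrite mulr_ge0 ?(ltW (w_gt0 G')) // mxE ler0n.
  rewrite subr_gt0 ltr_pdivrMr // mul1r (bigD1 G) //= [ltRHS](bigD1 G) //=.
  rewrite mxE (negbTE pG) mulr0 add0r ltr_pwDl //.
  apply: ler_sum => G' _; rewrite ler_piMr ?(ltW (w_gt0 G')) //.
  by case/andP: (adj01 p.1 p.2 G').
have row_meanE G G' : rows S G = rows S G' -> row_mean S G = row_mean S G'.
  by move=> e; apply/matrixP => i j; rewrite !mxE; exact: factors_cond_expect.
have sub1 : \sum_G c * bernoulli_graph (row_mean S G) G <= 1.
  rewrite -mulr_sumr mulrC ler_pdivrMr ?exprn_gt0 // mul1r.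
  (* On one row pattern [row_mean] is constant, so the fibre carries at most the total mass 1 of one
     product measure. *)
  rewrite (partition_big (rows S) [in powerset (finset.setX S finset.setT)]) /=.
    apply: (@le_trans _ _ (\sum_(s in powerset (finset.setX S [set: 'I_N])) 1)).
      apply: ler_sum => s _.
      have [G0 /eqP <-|no] := pickP (fun G => rows S G == s); last first.
        by rewrite big_pred0.
      rewrite -(sum_bernoulli_graph (row_mean S G0)) [leRHS](bigID (fun G =>
        rows S G == rows S G0)) /= -[leLHS]addr0 lerD ?sumr_ge0 //.
        by apply: ler_sum => G /eqP /row_meanE ->.
      by move=> G _; apply: bernoulli_graph_ge0 => i j; exact: row_mean_itv.
    rewrite sumr_const card_powerset cardsX cardsT card_ord.
    by rewrite natrX.
  move=> G _; rewrite powersetE; apply/fintype.subsetP => p; rewrite !inE.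
  by case/andP=> _ ->.
have := @gibbs_inequality R _ w
  (fun G => c * bernoulli_graph (row_mean S G) G) (fun G => ltW (w_gt0 G))
  (fun G => ltW (mulr_gt0 c0 (b0 G))) (fun G _ => mulr_gt0 c0 (b0 G))
  w_sum1 sub1.
have lnc : ln c = - ((#|S| * N)%:R * ln 2).
  by rewrite lnV ?posrE ?exprn_gt0 // lnXn // mulr_natl.
rewrite (_ : \sum_G _ = ln c + expect w (fun G => I_ent_mx (row_mean S G))).
  by rewrite lnc /expect; lra.
transitivity (ln c + \sum_(p : 'I_N * 'I_N | (p.1 < p.2)%N)
    expect w (fun G => adj_mx R G p.1 p.2 * ln (row_mean S G p.1 p.2) +
      (1 - adj_mx R G p.1 p.2) * ln (1 - row_mean S G p.1 p.2))).
  have {1}-> : ln c = \sum_G w G * ln c by rewrite -mulr_suml w_sum1 mul1r.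
  rewrite [X in _ + X]exchange_big -big_split; apply: eq_bigr => G _ /=.
  rewrite lnM ?posrE // ln_bernoulli_graph //; last exact: row_mean_itv.
  rewrite mulrDr mulr_sumr; congr (_ + _); apply: eq_bigr => p _.
  by rewrite !mxE.
congr (_ + _); rewrite /expect /I_ent_mx.
under [RHS]eq_bigr do rewrite mulr_sumr.
rewrite [RHS]exchange_big; apply: eq_bigr => p _ /=.
pose X G := adj_mx R G p.1 p.2; pose m G := row_mean S G p.1 p.2.
have fac (h : R -> R) : factors (rows S) (fun G => h (m G)).
  by move=> G G' /row_meanE e; rewrite /m e.
(* Functions of [m] are determined by the rows, so [X] may be replaced by its conditional
   expectation [m]. *)
have E (h : R -> R) : expect w (fun G => X G * h (m G)) =
                      expect w (fun G => m G * h (m G)).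
  rewrite -(expect_cond_expect w_gt0 X (fac h)); apply: eq_bigr => G _.
  by rewrite {2}/m mxE.
have := congr2 +%R (E (@ln R)) (congr1 (fun t => expect w
  (fun G => ln (1 - m G)) - t) (E (fun t => ln (1 - t)))).
rewrite /expect -!sumrB -!big_split /= => E'.
transitivity (\sum_G (w G * (X G * ln (m G)) +
  (w G * ln (1 - m G) - w G * (X G * ln (1 - m G))))).
  by apply: eq_bigr => G _; rewrite /X /m; ring.
rewrite E'; apply: eq_bigr => G _; rewrite /I_ent /m; ring.
Qed.

End RowMean.

(** * Product measures and non-injective maps *)

(** Resample [q a]: exactly one of its [#|V|] values collides with the unchanged [q b]. *)
Lemma sum_eq_coord (R : realType) (K V : finType) (a b : K) : a != b ->
  #|V|%:R * \sum_(q : {ffun K -> V}) (q a == q b)%:R = #|{ffun K -> V}|%:R :> R.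
Proof.
move=> ab; rewrite -(sum_resample (fun q : {ffun K -> V} => (q a == q b)%:R) a).
rewrite -sum1_card natr_sum; apply: eq_bigr => q _.
have ba : (b == a) = false by rewrite eq_sym (negbTE ab).
rewrite (bigD1 (q b)) //= !ffunE eqxx ba eqxx big1 ?addr0 //.
by move=> x /negbTE xb; rewrite !ffunE eqxx ba xb.
Qed.

(** An injective [q] sends distinct edges of [H] to distinct vertex pairs, whose indicators are
    independent. *)
Lemma bernoulli_graph_injective_copy (R : realType) N (x : 'M[R]_N) k
    (H : sgraph k) (q : 'I_k -> 'I_N) :
  P_ x -> injective q ->
  \sum_G bernoulli_graph x G *
    \prod_(p | sorted_edge H p) adj_mx R G (q p.1) (q p.2) =
  \prod_(p | sorted_edge H p) x (q p.1) (q p.2).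
Proof.
move=> [x01 x0 xC] qI.
(* Sorts the image of an edge, because the product measure is indexed by increasing pairs. *)
pose h (p : 'I_k * 'I_k) := if (q p.1 < q p.2)%N then (q p.1, q p.2)
                            else (q p.2, q p.1).
have hI : {in sorted_edge H &, injective h}.
  move=> [a b] [a' b']; rewrite -!topredE /= => /andP[/= ab _] /andP[/= ab' _].
  rewrite /h /=; case: ifP => _; case: ifP => _ [/qI e1 /qI e2]; subst => //.
  - by have := ltn_trans ab ab'; rewrite ltnn.
  - by have := ltn_trans ab ab'; rewrite ltnn.
have hlt p : p \in [set h p | p in sorted_edge H]%SET -> (p.1 < p.2)%N.
  case/imsetP => -[a b]; rewrite -topredE /= => /andP[/= ab _] ->.
  rewrite /h /=; have [//|//|/val_inj/qI e] := ltngtP (q a) (q b).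
  by move: ab; rewrite e ltnn.
have hE (F : 'M[R]_N) : (forall i j, F j i = F i j) ->
    \prod_(p in [set h p | p in sorted_edge H]%SET) F p.1 p.2 =
    \prod_(p | sorted_edge H p) F (q p.1) (q p.2).
  move=> FC; rewrite big_imset //=; apply: eq_bigr => p _.
  by rewrite /h; case: ifP => _ //=.
rewrite -(hE _ xC) -(bernoulli_graph_edges _ hlt); apply: eq_bigr => G _.
rewrite -hE; first by congr (_ * _); apply: eq_bigr => p _; rewrite mxE.
by move=> i j; rewrite !mxE adj_sym.
Qed.

(** Injective maps contribute no error and others at most 1 each; the latter are counted by a union
    bound over pairs of vertices of [H], each colliding with probability [1 / N]. *)
Lemma bernoulli_graph_hom_density (R : realType) N (x : 'M[R]_N) k
    (H : sgraph k) : (0 < N)%N -> P_ x ->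
  `|\sum_G bernoulli_graph x G * hom_density_mx H (adj_mx R G) -
    hom_density_mx H x| <= (k ^ 2)%:R / N%:R.
Proof.
move=> N0 xP; have [x01 _ _] := xP.
have n0 : 0 < N%:R :> R by rewrite ltr0n.
pose t (y : 'M[R]_N) (q : {ffun 'I_k -> 'I_N}) :=
  \prod_(p | sorted_edge H p) y (q p.1) (q p.2).
rewrite (_ : _ - _ = (N%:R ^+ k)^-1 * \sum_(q : {ffun 'I_k -> 'I_N})
   (\sum_G bernoulli_graph x G * t (adj_mx R G) q - t x q)); last first.
  rewrite sumrB exchange_big mulrBr mulr_sumr; congr (_ - _).
  by apply: eq_bigr => G _; rewrite -mulr_sumr mulrCA.
rewrite normrM gtr0_norm ?invr_gt0 ?exprn_gt0 // ler_pdivrMl ?exprn_gt0 //.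
apply: (le_trans (ler_norm_sum _ _ _)).
apply: (@le_trans _ _ (\sum_(q : {ffun 'I_k -> 'I_N})
    \sum_(p : 'I_k * 'I_k | p.1 != p.2) (q p.1 == q p.2)%:R)).
  apply: ler_sum => q _.
  have [/injectiveP qI|] := boolP (injectiveb q).
    rewrite bernoulli_graph_injective_copy // subrr normr0.
    by apply: sumr_ge0 => p _; rewrite ler0n.
  move=> /injectivePn[a [b ab qab]].
  rewrite (bigD1 (a, b)) //= qab eqxx; apply: ler_wpDr.
    by apply: sumr_ge0 => p _; rewrite ler0n.
  have /andP[tx0 tx1] := prod_sorted_edge_itv H q x01.
  rewrite ler_norml; apply/andP; split.
    rewrite lerBrDr (le_trans _ (sumr_ge0 _ _)) //; last first.
      move=> G _; rewrite mulr_ge0 ?bernoulli_graph_ge0 //.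
      by have /andP[] := prod_sorted_edge_itv H q (@adj_mx_itv R N G).
    by rewrite addrC subr_le0.
  rewrite lerBlDr -[leLHS]addr0 lerD // -(sum_bernoulli_graph x).
  apply: ler_sum => G _; rewrite ler_piMr ?bernoulli_graph_ge0 //.
  by have /andP[] := prod_sorted_edge_itv H q (@adj_mx_itv R N G).
rewrite exchange_big /= mulrA ler_pdivlMr // mulr_suml.
apply: (@le_trans _ _ (\sum_(p : 'I_k * 'I_k | p.1 != p.2) N%:R ^+ k)).
  apply: ler_sum => p pp; rewrite mulrC.
  by have := sum_eq_coord R 'I_N pp; rewrite card_ffun !card_ord natrX => ->.
rewrite sumr_const -[leLHS]mulr_natr ler_pM2l ?exprn_gt0 // ler_nat.
by apply: (leq_trans (max_card _)); rewrite card_prod card_ord.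
Qed.

(** * Comparison with the mean-field functional *)

Section MeanField.
Variables (R : realType) (l : nat) (k : 'I_l -> nat).
Variables (H : forall i : 'I_l, sgraph (k i)) (beta : 'I_l -> R) (N : nat).
Hypothesis N_gt0 : (0 < N)%N.

Let n : R := N%:R.
(** Without the leading 1 of the theorem's [B]. *)
Let B : R := \sum_(i < l) `|beta i|.
Let K : nat := (\sum_(i < l) k i ^ 2)%N.

Definition hamiltonian (x : 'M[R]_N) : R :=
  \sum_(i < l) beta i * hom_density_mx (H i) x.

Definition gibbs_weight (G : sgraph N) : R :=
  expR (n ^+ 2 * hamiltonian (adj_mx R G)) / Z_ H beta N.

Lemma Z_E : Z_ H beta N = \sum_G expR (n ^+ 2 * hamiltonian (adj_mx R G)).
Proof.
apply: eq_bigr => G _; congr (expR (_ * _)); apply: eq_bigr => i _.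
by rewrite hom_density_adj_mx.
Qed.

Lemma Z_gt0 : 0 < Z_ H beta N.
Proof.
have G0 : sgraph N by exists (upper_sym [ffun=> false]); exact: upper_sym_sgraph.
rewrite Z_E (bigD1 G0) //= ltr_pwDl ?expR_gt0 //.
by apply: sumr_ge0 => G _; exact: expR_ge0.
Qed.

Lemma gibbs_weight_gt0 G : 0 < gibbs_weight G.
Proof. by rewrite divr_gt0 ?expR_gt0 ?Z_gt0. Qed.

Lemma gibbs_weight_sum1 : \sum_G gibbs_weight G = 1.
Proof. by rewrite -mulr_suml -Z_E divff ?gt_eqF ?Z_gt0. Qed.

Lemma ln_gibbs_weight G :
  ln (gibbs_weight G) = n ^+ 2 * hamiltonian (adj_mx R G) - ln (Z_ H beta N).
Proof. by rewrite ln_div ?posrE ?expR_gt0 ?Z_gt0 // expRK. Qed.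

Let kK i : (k i ^ 2 <= K)%N.
Proof. by rewrite /K (bigD1 i) //= leq_addr. Qed.

(** Carries density errors over to the Hamiltonian, with [e = 1 / n] for the product measure and
    [e = d] for the Gibbs measure. *)
Lemma hamiltonian_linear_error (Om : finType) (w : Om -> R)
    (y y' : Om -> 'M[R]_N) (e : R) : 0 <= e ->
  (forall i, `|\sum_o w o * (hom_density_mx (H i) (y o) -
                             hom_density_mx (H i) (y' o))|
             <= (k i ^ 2)%:R * e) ->
  \sum_o w o * hamiltonian (y o) <=
  \sum_o w o * hamiltonian (y' o) + B * K%:R * e.
Proof.
move=> e0 he; rewrite -lerBlDl -sumrB.
have -> : \sum_o (w o * hamiltonian (y o) - w o * hamiltonian (y' o)) =
    \sum_i beta i * \sum_o w o * (hom_density_mx (H i) (y o) -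
                             hom_density_mx (H i) (y' o)).
  under [RHS]eq_bigr do rewrite mulr_sumr.
  rewrite [RHS]exchange_big; apply: eq_bigr => o _ /=.
  rewrite -mulrBr /hamiltonian -sumrB mulr_sumr; apply: eq_bigr => i _.
  by ring.
rewrite /B -mulrA mulr_suml; apply: ler_sum => i _.
apply: le_trans (ler_norm _) _; rewrite normrM ler_wpM2l //.
by apply: le_trans (he i) _; rewrite ler_wpM2r // ler_nat.
Qed.

(** Gibbs' inequality for the product measure against the Gibbs measure; the last term is the cost
    of non-injective maps. *)
Lemma ln_Z_lower (x : 'M[R]_N) : P_ x ->
  hamiltonian x - I_ent_mx x / n ^+ 2 <=
  ln (Z_ H beta N) / n ^+ 2 + B * K%:R / n.
Proof.
move=> xP; have [x01 _ _] := xP.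
have n0 : 0 < n by rewrite ltr0n.
have n20 : 0 < n ^+ 2 by rewrite exprn_gt0.
have sb := sum_bernoulli_graph x.
have := gibbs_inequality (fun G => bernoulli_graph_ge0 G x01)
  (fun G => ltW (gibbs_weight_gt0 G)) (fun G _ => gibbs_weight_gt0 G) sb.
rewrite gibbs_weight_sum1 => /(_ (lexx _)); rewrite bernoulli_graph_entropy //.
under eq_bigr => G _ do rewrite ln_gibbs_weight mulrBr mulrCA.
rewrite sumrB -mulr_sumr -mulr_suml sb mul1r => h1.
have h2 : hamiltonian x <= \sum_G bernoulli_graph x G *
    hamiltonian (adj_mx R G) + B * K%:R * n^-1.
  rewrite -{1}[hamiltonian x]mul1r -{1}sb mulr_suml.
  apply: hamiltonian_linear_error; first by rewrite invr_ge0 ltW.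
  move=> i; apply: le_trans (bernoulli_graph_hom_density (H i) N_gt0 xP).
  rewrite -normrN -sumrN le_eqVlt; apply/orP; left; apply/eqP; congr (`|_|).
  rewrite -[hom_density_mx (H i) x in RHS]mul1r -sb mulr_suml -sumrB.
  by apply: eq_bigr => G _; ring.
apply: le_trans (lerB h2 (lexx _)) _.
rewrite addrAC lerD2r lerBlDr -mulrDl ler_pdivlMr // mulrC.
by move: h1; lra.
Qed.

(* The number of rows revealed, hence the entropy spent on them, is chosen
   according to [d], which controls the error in the densities. *)
Lemma ln_Z_upper (d M : R) : 0 < d ->
  (forall x : 'M[R]_N, P_ x -> hamiltonian x - I_ent_mx x / n ^+ 2 <= M) ->
  ln (Z_ H beta N) / n ^+ 2 <= M + B * K%:R * d + K%:R * (d ^- 2 + 1) / n.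
Proof.
move=> d0 leM.
have n0 : 0 < n by rewrite ltr0n.
have n20 : 0 < n ^+ 2 by rewrite exprn_gt0.
have w0 := gibbs_weight_gt0; have w1 := gibbs_weight_sum1.
(* Batches of [K] vertices serve every [H i], as [k i <= k i ^ 2 <= K]. *)
have [S [cS goodS]] := energy_increment K
  (mean_energy_itv w0 w1 N_gt0) (exprn_gt0 2 d0).
have kK' i : (k i <= K)%N.
  by apply: leq_trans (kK i); case: (k i) => // m; rewrite leq_pmull.
have h1 := entropy_rows w0 w1 S.
have h2 : expect gibbs_weight (fun G => hamiltonian (adj_mx R G)) <=
  expect gibbs_weight (fun G => hamiltonian (row_mean gibbs_weight S G)) +
    B * K%:R * d.
  apply: hamiltonian_linear_error => [|i]; first exact: ltW.
  exact: (hom_density_row_mean w0 w1 N_gt0 (H i) d0 (kK' i) goodS).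
(* Every realised [row_mean] is a point of [P_], where the functional is at most [M]. *)
have h3 : expect gibbs_weight (fun G =>
    hamiltonian (row_mean gibbs_weight S G) -
    I_ent_mx (row_mean gibbs_weight S G) / n ^+ 2) <= M.
  rewrite -[M]mul1r -w1 mulr_suml; apply: ler_sum => G _.
  by rewrite ler_wpM2l ?leM ?(ltW (w0 G)) //; exact: row_mean_P.
have ln2 : ln 2 <= 1 :> R.
  have := @le_ln1Dx R 1; rewrite (_ : 1 + 1 = 2) //; apply.
  by lra.
have S0 : (#|S| * N)%:R * ln 2 <= K%:R * (d ^- 2 + 1) * n.
  rewrite natrM (le_trans (ler_wpM2l _ ln2)) ?mulr_ge0 // mulr1.
  by rewrite ler_wpM2r // ltW.
have h4 : expect gibbs_weight (fun G => ln (gibbs_weight G)) =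
    n ^+ 2 * expect gibbs_weight (fun G => hamiltonian (adj_mx R G)) -
    ln (Z_ H beta N).
  rewrite -[ln (Z_ _ _ _)]mul1r -w1 mulr_suml mulr_sumr -sumrB.
  by apply: eq_bigr => G _; rewrite ln_gibbs_weight; ring.
have h5 : expect gibbs_weight (fun G =>
    hamiltonian (row_mean gibbs_weight S G) -
    I_ent_mx (row_mean gibbs_weight S G) / n ^+ 2) =
  expect gibbs_weight (fun G => hamiltonian (row_mean gibbs_weight S G)) -
  expect gibbs_weight (fun G => I_ent_mx (row_mean gibbs_weight S G)) / n ^+ 2.
  by rewrite /expect mulr_suml -sumrB; apply: eq_bigr => G _; ring.
rewrite ler_pdivrMr //.
have -> : (M + B * K%:R * d + K%:R * (d ^- 2 + 1) / n) * n ^+ 2 =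
  n ^+ 2 * M + n ^+ 2 * (B * K%:R * d) + K%:R * (d ^- 2 + 1) * n.
  by field; rewrite !gt_eqF.
have := ler_wpM2l (ltW n20) h2; have := ler_wpM2l (ltW n20) h3.
rewrite h5 mulrBr (mulrC _ (_ / _)) divfK ?gt_eqF // mulrDr.
by move: h1; rewrite h4; lra.
Qed.

End MeanField.

(** * Choice of the error parameter and final constants *)

Unset Implicit Arguments.

Theorem theorem1p7 (R : realType) (l : nat) (l_gt0 : (0 < l)%N)
    (k : 'I_l -> nat) (H : forall i : 'I_l, sgraph (k i)) :
  exists C c : R, forall (beta : 'I_l -> R) (N : nat), (0 < N)%N ->
    let B : R := 1 + \sum_(i < l) `|beta i| in
    let n : R := N%:R in
    let D : R := ln (Z_ H beta N) / n ^+ 2 - L_ H beta N in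
    - c * B * n^-1 <= D /\
    D <= C * B `^ (8 / 5) * n `^ (- (1 / 5)) * ln n `^ (1 / 5)
           * (1 + ln B / ln n)
         + C * B ^+ 2 * n `^ (- (1 / 2)).
Proof.
pose K : R := (\sum_(i < l) k i ^ 2)%N%:R.
have K0 : 0 <= K by rewrite ler0n.
have ln20 : 0 < ln 2 :> R by rewrite ln_gt0 // ltr1n.
have ln21 : ln 2 <= 1 :> R.
  have := @le_ln1Dx R 1; rewrite (_ : 1 + 1 = 2) //; apply.
  by lra.
(* A lower bound for the logarithmic factor once [N >= 2]; [C] is divided by it to compensate. *)
pose a : R := ln 2 `^ (1 / 5).
have a0 : 0 < a by rewrite powR_gt0.
have a1 : a <= 1.
  have e : 1 `^ (1 / 5) = 1 :> R by rewrite powR1.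
  by rewrite -[leRHS]e; apply: ge0_ler_powR; rewrite ?nnegrE //; lra.
exists (3 * K / a), K => beta N N0 B n D.
have C0 : 0 <= 3 * K / a by rewrite divr_ge0 ?(ltW a0) ?mulr_ge0.
have B1 : 1 <= B by rewrite lerDl; apply: sumr_ge0.
have B0 : 0 <= B := le_trans ler01 B1.
have n1 : 1 <= n by rewrite ler1n.
have n0 : 0 < n := lt_le_trans ltr01 n1.
pose V := [set hamiltonian H beta x - I_ent_mx x / n ^+ 2 | x in @P_ R N]%classic.
have LE : L_ H beta N = sup V by [].
have V0 : (V !=set0)%classic.
  exists (hamiltonian H beta (0 : 'M[R]_N) - I_ent_mx (0 : 'M[R]_N) / n ^+ 2).
  by exists 0 => //; split=> [i j|i|i j]; rewrite !mxE ?lexx ?ler01.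
(* Serves twice: it makes [sup V] a genuine supremum, and it yields the left inequality. [B - 1] is
   the sum of the [|beta i|]. *)
have Vub : ubound V (ln (Z_ H beta N) / n ^+ 2 + (B - 1) * K / n).
  move=> _ [x xP <-]; have := ln_Z_lower H beta N0 xP.
  by rewrite /B (addrC 1) addrK.
have L_ub (x : 'M[R]_N) : P_ x -> hamiltonian H beta x - I_ent_mx x / n ^+ 2 <= L_ H beta N.
  move=> xP; rewrite LE; apply: ub_le_sup; last by exists x.
  by eexists; exact: Vub.
split.
  rewrite /D lerBrDl -lerBrDr mulNr mulNr opprK LE.
  apply: (le_trans (ge_sup V0 Vub)); rewrite lerD2l.
  by rewrite ler_wpM2r ?invr_ge0 ?(ltW n0) // mulrC ler_wpM2l // gerBl.
(* The power of [N] in the claim. As [d ^ 5 = 1 / n], the entropy cost [(d ^- 2 + 1) / n] equals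
   [d ^ 3 + d ^ 5], at most [2 * d]. *)
pose d : R := n `^ (- (1 / 5)).
have d0 : 0 < d by rewrite powR_gt0.
have d1 : d <= 1 by rewrite -[leRHS](powRr0 n) ler_powR // oppr_le0; lra.
have d5 : d ^+ 5 = n^-1.
  rewrite -powR_mulrn ?(ltW d0) // -powRrM -[RHS]powR_inv1 ?(ltW n0) //.
  by congr (_ `^ _); lra.
have Kd : 0 <= K * d by rewrite mulr_ge0 // ltW.
have Dle : D <= 3 * K * B * d.
  have := ln_Z_upper N0 d0 L_ub; rewrite -/K -/n.
  have : K * (d ^- 2 + 1) / n <= 2 * K * d.
    rewrite -d5.
    have -> : K * (d ^- 2 + 1) * d ^+ 5 = K * d * (d ^+ 2 + d ^+ 4).
      by field; rewrite gt_eqF.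
    have : d ^+ 2 <= 1 by rewrite exprn_ile1 // ltW.
    have : d ^+ 4 <= 1 by rewrite exprn_ile1 // ltW.
    by move=> h4 h2; have := ler_wpM2l Kd (lerD h2 h4); lra.
  have : K * d <= K * B * d.
    by rewrite ler_wpM2r ?(ltW d0) // ler_peMr.
  rewrite /D (_ : \sum_(i < l) `|beta i| = B - 1); last by rewrite /B; ring.
  by lra.
apply: (le_trans Dle).
(* For [N = 1], [ln n = 0] kills the first term of the bound, and [C * B ^+ 2] suffices because
   [a <= 1] gives [C >= 3 * K]. *)
have [N2|] := ltnP 1 N; last first.
  move=> Nle; have nE : n = 1.
    by rewrite /n (_ : N = 1%N) //; apply/eqP; rewrite eqn_leq Nle.
  rewrite /d nE !powR1 !mulr1 ln1 powR0 ?mulr0 ?mul0r ?add0r; last by lra.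
  have : B <= B ^+ 2 by rewrite expr2 ler_peMr.
  have K3 : 0 <= 3 * K by rewrite mulr_ge0.
  by move=> BB; apply: ler_pM => //; rewrite ler_pdivlMr // ler_piMr.
(* For [N >= 2] the first term alone suffices, compared factor by factor. *)
apply: ler_wpDr.
  by apply: mulr_ge0; rewrite ?powR_ge0 // mulr_ge0 // exprn_ge0.
have lnn : ln 2 <= ln n.
  by rewrite ler_ln ?posrE // ler_nat.
have lnn0 : 0 < ln n := lt_le_trans ln20 lnn.
have an : a <= ln n `^ (1 / 5).
  by apply: ge0_ler_powR; rewrite ?nnegrE //; lra.
have BB : B <= B `^ (8 / 5) by apply: le1r_powR => //; lra.
have q1 : 1 <= 1 + ln B / ln n.
  by rewrite lerDl divr_ge0 ?ln_ge0 // ltW.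
rewrite -[leLHS]mulr1; apply: ler_pM => //; first by rewrite !mulr_ge0 // ltW.
rewrite -/d [leRHS]mulrAC ler_wpM2r ?(ltW d0) //.
rewrite (_ : 3 * K * B = 3 * K / a * B * a); last by field; rewrite gt_eqF.
apply: ler_pM => //; [exact: mulr_ge0|exact: ltW|exact: ler_wpM2l].
Qed.
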